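(* Let $p,q,k,n$ be positive integers such that $k > p$, $q\geq kp$ and $n\leq (q-p)\left(\frac{q}{kp} +1\right)^{k-p-1}$. Then for all integers $k\leq b_1\leq\ldots\leq b_n$, Avoider has a winning strategy in the game monotone-$mBox(b_1, \ldots, b_n,(p,q))$, both as the first and as the second player.
   Context: In a $(p,q)$ Avoider-Enforcer game on a finite board $X$ with target family $\mathcal F\subseteq 2^X$ played according to the monotone rules, Avoider and Enforcer alternately claim at least $p$ and at least $q$ previously unclaimed elements of $X$ per move, respectively; if fewer than $p$ (resp. $q$) unclaimed elements remain before Avoider's (resp. Enforcer's) move, he claims all of them. It is specified which player moves first. The game ends when all elements are claimed; Avoider loses if at the end he has claimed all elements of some target set, otherwise Avoider wins. The game monotone-$mBox(b_1,\ldots,b_n,(p,q))$ is this game (monotone rules) on the board consisting of the disjoint union of pairwise disjoint sets (boxes) $B_1,\ldots,B_n$ with $|B_i|=b_i$, with target sets exactly $B_1,\ldots,B_n$. *)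

(* Defs.v *)
From mathcomp Require Import all_boot all_order all_algebra.

Set Implicit Arguments.
Unset Strict Implicit.
Unset Printing Implicit Defensive.

Variant player := Avoider | Enforcer.

Definition opponent (P : player) : player :=
  match P with Avoider => Enforcer | Enforcer => Avoider end.

Section MonotoneAvoiderEnforcer.

Variables (X : finType) (F : {set {set X}}) (p q : nat) (first : player).

(* The list of the sets claimed so far, one per move, the latest move at the
   head. *)
Definition history := seq {set X}.

Implicit Types (h : history) (M U : {set X}).

Definition to_move h : player :=
  if odd (size h) then opponent first else first.

Definition unclaimed h : {set X} := ~: \bigcup_(M <- h) M.

Fixpoint claimed_by_avoider h : {set X} :=
  match h with
  | [::] => set0
  | M :: h' =>
      match to_move h' with
      | Avoider => M :|: claimed_by_avoider h'
      | Enforcer => claimed_by_avoider h'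
      end
  end.

Definition bias (P : player) : nat :=
  match P with Avoider => p | Enforcer => q end.

Definition game_over h : bool := unclaimed h == set0.

Definition legal_move h M : bool :=
  let r := bias (to_move h) in
  let U := unclaimed h in
  if #|U| < r then M == U else (M \subset U) && (r <= #|M|).

Inductive legal_history : history -> Prop :=
| legal_nil : legal_history [::]
| legal_cons h M :
    legal_history h -> ~~ game_over h -> legal_move h M ->
    legal_history (M :: h).

Definition avoider_strategy (sigma : history -> {set X}) : Prop :=
  forall h, legal_history h -> ~~ game_over h -> to_move h = Avoider ->
    legal_move h (sigma h).

Fixpoint follows (sigma : history -> {set X}) h : Prop :=
  match h with
  | [::] => True
  | M :: h' => (to_move h' = Avoider -> M = sigma h') /\ follows sigma h'
  end.

Definition avoider_loses h : Prop :=
  exists2 T : {set X}, T \in F & T \subset claimed_by_avoider h.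

(* For p, q > 0 every move made before the end of the game claims an element,
   so every play is finite and reaches [game_over]. *)
Definition avoider_has_winning_strategy : Prop :=
  exists2 sigma : history -> {set X}, avoider_strategy sigma &
    forall h, legal_history h -> follows sigma h -> game_over h ->
      ~ avoider_loses h.

End MonotoneAvoiderEnforcer.

Section BoxGame.

Variables (n : nat) (b : 'I_n -> nat).

Definition board : finType := {i : 'I_n & 'I_(b i)}.

Definition box (i : 'I_n) : {set board} := [set x | tag x == i].

Definition boxes : {set {set board}} := [set box i | i : 'I_n].

End BoxGame.

Definition avoider_wins_mBox (n : nat) (b : 'I_n -> nat) (p q : nat)
    (first : player) : Prop :=
  @avoider_has_winning_strategy (board b) (boxes b) p q first.

(* Main.v *)
(** Call a box live while Enforcer holds none of its elements, and put
    [a = q / (k p)].  Whenever Avoider is to move there is a level [s], with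
    [p <= s < k], such that every live box has at least [max(s, p + 1)] unclaimed
    elements and
      [#live boxes + a * #live boxes of size s <= (q - p) (a + 1)^(s - p)].
    If at most [q] boxes are live, Avoider claims everything except one element in
    each of them: Enforcer must then take all the rest and touches every box.
    Otherwise Avoider claims all elements of dead boxes, cuts the live boxes down
    to at most [s + 1] elements, and then takes [p] further elements one at a time
    from a largest live box.  Each of these raises the left-hand side by at most
    [a]; when all the boxes have reached size [s], the left-hand side is [(a + 1)]
    times the number of live boxes, so one can pass to level [s - 1].  Enforcer
    answers by touching at least [q / k = a p] live boxes, which restores the
    inequality. *)

Require Import Defs.
From mathcomp Require Import all_boot all_order all_algebra.
From mathcomp Require Import zify ring lra.

Set Implicit Arguments.
Unset Strict Implicit.
Unset Printing Implicit Defensive.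

Import Order.TTheory GRing.Theory Num.Theory.

(** * Strategies obtained from invariants of the general monotone game *)

Section Strategies.

Variables (X : finType) (F : {set {set X}}) (p q : nat) (first : player).

Local Notation history := (history X).
Local Notation to_move := (@to_move X first).
Local Notation legal_move := (@legal_move X p q first).
Local Notation legal_history := (@legal_history X p q first).
Local Notation claimed := (@claimed_by_avoider X first).

Implicit Types (h : history) (M : {set X}).

Lemma unclaimed_nil : unclaimed [::] = [set: X].
Proof. by rewrite /unclaimed big_nil setC0. Qed.

Lemma unclaimed_cons M h : unclaimed (M :: h) = unclaimed h :\: M.
Proof. by rewrite /unclaimed big_cons setCU setDE setIC. Qed.

Lemma claimed_by_avoider_disjoint h : [disjoint claimed h & unclaimed h].
Proof.
elim: h => [|M h IH] /=; first by rewrite disjoints_subset sub0set.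
rewrite unclaimed_cons; case: (to_move h).
  rewrite disjoints_subset subUset -!disjoints_subset.
  rewrite (disjointWr (subsetDl _ _) IH) andbT.
  by rewrite disjoints_subset setDE setCI setCK subsetUr.
exact: disjointWr (subsetDl _ _) IH.
Qed.

Lemma legal_move_unclaimed h : legal_move h (unclaimed h).
Proof. by rewrite /Defs.legal_move; case: ltnP => //=; rewrite subxx. Qed.

(** Claiming everything that is left is legal whether or not the bias can be met, so the two cases
    of the rule merge into one disjunction. *)
Lemma legal_moveP h M :
  legal_move h M <->
  M \subset unclaimed h /\ (bias p q (to_move h) <= #|M| \/ M = unclaimed h).
Proof.
rewrite /Defs.legal_move; case: ltnP => [lt|le]; split.
- by move=> /eqP->; split=> //; right.
- move=> [sM [le|->//]]; have := subset_leq_card sM; lia.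
- by case/andP; split; [|left].
- by move=> [sM [->|MU]]; rewrite sM // MU.
Qed.

Lemma to_move_cons M h : to_move (M :: h) = opponent (to_move h).
Proof. by rewrite /Defs.to_move /=; case: odd; case: first. Qed.

Lemma winning_strategy_of_invariant (I : pred history) :
    I [::] ->
    (forall h, to_move h = Avoider -> I h ->
       exists2 M, legal_move h M & I (M :: h)) ->
    (forall h M, to_move h = Enforcer -> I h -> legal_move h M -> I (M :: h)) ->
    (forall h, game_over h -> I h -> ~ avoider_loses F first h) ->
  avoider_has_winning_strategy F p q first.
Proof.
move=> I0 IA IE Iend.
pose good h M := legal_move h M && I (M :: h).
(* The default keeps [sigma] legal even at histories where the invariant fails. *)
pose sigma h := odflt (unclaimed h) [pick M | good h M].
exists sigma.
  move=> h _ _ _; rewrite /sigma; case: pickP => [M /andP[]//|_].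
  exact: legal_move_unclaimed.
move=> h lh fh overh; apply: Iend => //.
elim: lh fh {overh} => [//|{}h M lh IH _ lM /= [Msigma /IH Ih]].
case E: (to_move h); last exact: IE.
rewrite Msigma // /sigma; case: pickP => [N /andP[]//|none].
by have [N lN IN] := IA _ E Ih; have := none N; rewrite /good lN IN.
Qed.

End Strategies.

(** * Live boxes and the effect of a move on them *)

Section Boxes.

Variables (n : nat) (b : 'I_n -> nat).

Implicit Types (A U K M : {set board b}).

Definition residue U i : nat := #|box b i :&: U|.

(* For [A] the set claimed by Avoider and [U] the unclaimed one, the live boxes
   are those in which Enforcer holds no element. *)
Definition live A U : {set 'I_n} := [set i | box b i \subset A :|: U].

Lemma mem_boxI U i x : (x \in box b i :&: U) = (tag x == i) && (x \in U).
Proof. by rewrite !inE. Qed.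

Lemma card_box i : #|box b i| = b i.
Proof.
pose T (x : 'I_(b i)) : board b := Tagged (fun j => 'I_(b j)) x.
have injT : injective T by move=> x y /eqP; rewrite eq_Tagged => /eqP.
rewrite -[RHS]card_ord -cardsT -(card_imset _ injT); apply: eq_card => x.
rewrite !inE; apply/eqP/imsetP => [ti|[y _ ->]//].
by case: x ti => j x /= ji; move: x; rewrite ji => x; exists x.
Qed.

Lemma card_residue U : #|U| = \sum_i residue U i.
Proof.
rewrite -sum1_card (partition_big (@tag _ _) predT) //=.
apply: eq_bigr => i _; rewrite /residue -sum1_card.
by apply: eq_bigl => x; rewrite mem_boxI andbC.
Qed.

Lemma residueS U M i : U \subset M -> residue U i <= residue M i.
Proof. by move=> sUM; apply/subset_leq_card/setIS. Qed.

(** Lets Avoider's moves be planned with numbers only: keep [r i] arbitrary elements of each box and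
    claim the others. *)
Lemma claim_to_residues U (r : 'I_n -> nat) :
    (forall i, r i <= residue U i) ->
  exists M : {set board b}, [/\ M \subset U, residue (U :\: M) =1 r
    & #|U| = #|M| + \sum_i r i].
Proof.
move=> rU; pose S i := [set x in take (r i) (enum (box b i :&: U))].
have SU i : S i \subset box b i :&: U.
  by apply/subsetP => x; rewrite inE => /mem_take; rewrite mem_enum.
pose K := \bigcup_i S i.
have KU : K \subset U.
  by apply/bigcupsP => i _; apply: subset_trans (SU i) (subsetIr _ _).
have UK : U :\: (U :\: K) = K by rewrite setDDr setDv set0U (setIidPr KU).
have rK : residue (U :\: (U :\: K)) =1 r.
  move=> i; rewrite UK /residue; have -> : box b i :&: K = S i.
    apply/setP => x; rewrite mem_boxI; apply/andP/idP => [[/eqP ti]|xS].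
      case/bigcupP => j _ xSj; have := subsetP (SU j) _ xSj.
      by rewrite mem_boxI ti => /andP[/eqP->].
    split; last by apply/bigcupP; exists i.
    by have := subsetP (SU i) _ xS; rewrite mem_boxI => /andP[].
  rewrite cardsE.
  have /card_uniqP -> : uniq (take (r i) (enum (box b i :&: U))).
    exact/take_uniq/enum_uniq.
  by apply: size_takel; rewrite -cardE; apply: rU.
exists (U :\: K); split; rewrite ?subsetDl //.
rewrite -(eq_bigr _ (fun i _ => rK i)) -card_residue UK addnC.
by rewrite -[in LHS](cardsID K) (setIidPr KU).
Qed.

Lemma live_avoider_move A U M :
  M \subset U -> live (M :|: A) (U :\: M) = live A U.
Proof.
move=> sMU; apply/setP => i; rewrite !inE; congr (_ \subset _).
by rewrite setUAC -{1}(setIidPr sMU) setID setUC.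
Qed.

Section EnforcerMove.

Variables (A U M : {set board b}).
Hypotheses (dAU : [disjoint A & U]) (sMU : M \subset U).

Lemma live_enforcer_move : live A (U :\: M) \subset live A U.
Proof.
apply/subsetP => i; rewrite !inE => /subset_trans; apply.
exact/setUS/subsetDl.
Qed.

Lemma live_enforcer_moveP x : x \in M -> tag x \notin live A (U :\: M).
Proof.
move=> xM; rewrite inE; apply/subsetP => /(_ x); rewrite !inE eqxx xM orbF.
by move=> /(_ isT) xA; have := disjointFr dAU xA; rewrite (subsetP sMU).
Qed.

(** Any element of [M] kills its box, so a box that stays live is untouched. *)
Lemma residue_enforcer_move i :
  i \in live A (U :\: M) -> residue (U :\: M) i = residue U i.
Proof.
move=> iL; congr #|pred_of_set _|; apply/setP => x; rewrite !inE.
case: eqP => //= ti; case xM: (x \in M) => //=.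
by have := live_enforcer_moveP xM; rewrite ti iL.
Qed.

Lemma live_enforcer_all :
  (forall i, i \in live A U -> 0 < residue U i) -> M = U ->
  live A (U :\: M) = set0.
Proof.
move=> rpos MU; apply/setP => i; rewrite in_set0; apply/negbTE/negP => iL.
have := rpos i (subsetP live_enforcer_move _ iL).
by rewrite -(residue_enforcer_move iL) MU setDv /residue setI0 cards0.
Qed.

End EnforcerMove.

End Boxes.

(** * The potential, computed from box sizes alone *)

Section Potential.

Variables (I : finType) (p q k : nat).
Hypotheses (p_gt0 : 0 < p) (p_lt_k : p < k) (kp_le_q : k * p <= q).

Implicit Types (L : {set I}) (r : I -> nat).

Definition slope : rat := (q%:R / (k%:R * p%:R))%R.

Definition threshold s : rat := ((q%:R - p%:R) * (slope + 1) ^+ (s - p))%R.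

Definition potential s L r : rat :=
  (#|L|%:R + slope * #|[set i in L | r i == s]|%:R)%R.

(** Here [j] counts the elements already taken one at a time in the current move; each is granted a
    slack of [slope]. *)
Definition low_potential s j L r : bool :=
  (potential s L r <= threshold s + slope * j%:R)%R.

Definition two_level s L r : bool := [forall i in L, s <= r i <= s.+1].

Lemma slope_gt0 : (0 < slope)%R.
Proof. by rewrite divr_gt0 -?natrM ?ltr0n //; nia. Qed.

Lemma slopeMp : (slope * p%:R * k%:R = q%:R)%R.
Proof.
by rewrite /slope; field; rewrite !pnatr_eq0 -!lt0n; lia.
Qed.

Lemma thresholdS s : p <= s -> threshold s.+1 = (threshold s * (slope + 1))%R.
Proof. by move=> ps; rewrite /threshold subSn // exprSr mulrA. Qed.

Lemma threshold_ge0 s : (0 <= threshold s)%R.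
Proof.
have := slope_gt0 => a0; rewrite mulr_ge0 ?exprn_ge0 //; last lra.
by rewrite subr_ge0 ler_nat; nia.
Qed.

Lemma low_potential0 s j r : low_potential s j set0 r.
Proof.
rewrite /low_potential /potential.
have -> : [set i in set0 | r i == s] = set0.
  by apply/setP => i; rewrite !inE.
rewrite cards0 mulr0 addr0 addr_ge0 ?threshold_ge0 // mulr_ge0 //.
exact/ltW/slope_gt0.
Qed.

Lemma potential_drop s L L' r r' :
    L' \subset L -> {in L', r' =1 r} ->
  (potential s L' r' + #|L :\: L'|%:R <= potential s L r)%R.
Proof.
move=> sL rr'; rewrite addrAC; apply: lerD.
  by rewrite -natrD -[in leRHS](cardsID L' L) (setIidPr sL).
rewrite ler_pM2l ?slope_gt0 // ler_nat; apply/subset_leq_card/subsetP => i.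
by rewrite !inE => /andP[iL]; rewrite (rr' _ iL) (subsetP sL).
Qed.

Lemma potentialS s L L' r r' :
  L' \subset L -> {in L', r' =1 r} -> (potential s L' r' <= potential s L r)%R.
Proof. by move=> sL /(potential_drop s sL); apply: le_trans; rewrite lerDl. Qed.

Definition decr i0 r : I -> nat := fun i => r i - (i == i0).

Lemma sum_decr L r i0 :
  i0 \in L -> 0 < r i0 -> \sum_(i in L) r i = (\sum_(i in L) decr i0 r i).+1.
Proof.
move=> i0L r0; rewrite (bigD1 i0) //= [in RHS](bigD1 i0) //= /decr eqxx.
rewrite -addSn subn1 prednK //; congr (_ + _).
by apply: eq_bigr => i /andP[_ /negbTE->]; rewrite subn0.
Qed.

Lemma claim_one s j L r :
    p < s < k -> q < #|L| -> j < p -> two_level s L r -> low_potential s j L r ->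
  exists s' r', [/\ p < s' < k, two_level s' L r', low_potential s' j.+1 L r',
    forall i, r' i <= r i & \sum_(i in L) r i = (\sum_(i in L) r' i).+1].
Proof.
move=> /andP[ps sk] qL jp /forall_inP lev lowp.
have a0 := slope_gt0.
case: (pickP [pred i in L | r i == s.+1]) => [i0 /andP[i0L /eqP ri0]|noS].
  exists s, (decr i0 r); split; rewrite ?ps //.
  - apply/forall_inP => i iL; have := lev i iL; rewrite /decr.
    by case: (eqVneq i i0) => [->|_]; lia.
  - move: lowp; rewrite /low_potential /potential.
    have -> : [set i in L | decr i0 r i == s] = i0 |: [set i in L | r i == s].
      apply/setP => i; rewrite !inE /decr; case: (eqVneq i i0) => [->|_] /=.
        by rewrite i0L ri0; lia.
      by rewrite subn0.
    rewrite cardsU1 !inE i0L ri0 eqn_leq ltnn /= natrD -(addn1 j) natrD; nra.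
  - by move=> i; apply: leq_subr.
  - by apply: sum_decr; rewrite ?ri0.
have rs i : i \in L -> r i = s.
  by move=> iL; have := lev i iL; have := noS i; rewrite /= iL /=; lia.
(* All boxes have size [s], so the level must drop; [s] now names the lower level. *)
case: s ps sk lev lowp noS rs => // s ps sk lev lowp noS rs.
have {}lowp : (#|L|%:R * (slope + 1) <=
               threshold s * (slope + 1) + slope * j%:R)%R.
  move: lowp; rewrite /low_potential /potential thresholdS //.
  have -> : [set i in L | r i == s.+1] = L.
    by apply/setP => i; rewrite !inE; case iL: (i \in L) => //=; rewrite rs ?eqxx.
  lra.
(* Dropping a level divides the slack [slope * j] by [slope + 1]; the one box then brought to size
   [s] adds [slope], which the slack for [j.+1] covers. *)
have Lle : (#|L|%:R <= threshold s + slope * j%:R / (slope + 1))%R.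
  have s10 : (0 < slope + 1)%R by lra.
  by rewrite -(ler_pM2r s10) mulrDl divfK // gt_eqF.
(* Dropping to level [p] would need more than [q] boxes of size exactly [p + 1],
   which the factor [q - p] in the threshold excludes. *)
have {ps} ps : p < s.
  rewrite ltn_neqAle -ltnS ps andbT; apply/eqP => eps; move: lowp.
  rewrite -eps /threshold subnn expr0 mulr1 => lowp.
  have jp' : (j%:R <= p%:R :> rat)%R by rewrite ler_nat ltnW.
  have qL' : (q%:R + 1 <= #|L|%:R :> rat)%R by rewrite natr1 ler_nat.
  have j0 : (0 <= j%:R :> rat)%R by [].
  nra.
have /card_gt0P[i0 i0L] : 0 < #|L| by lia.
exists s, (decr i0 r); split.
- by rewrite ps; lia.
- by apply/forall_inP => i iL; rewrite /decr rs //; case: eqVneq; lia.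
- rewrite /low_potential /potential.
  have -> : [set i in L | decr i0 r i == s] = [set i0].
    apply/setP => i; rewrite !inE /decr; case: (eqVneq i i0) => [->|ne].
      by rewrite i0L rs //; lia.
    by case iL: (i \in L) => //=; rewrite rs //; lia.
  rewrite cards1 -(addn1 j) natrD.
  have j0 : (0 <= slope * j%:R)%R by rewrite mulr_ge0 // ltW.
  have : (slope * j%:R / (slope + 1) <= slope * j%:R)%R.
    by rewrite ler_pdivrMr; [nra | lra].
  lra.
- by move=> i; apply: leq_subr.
- by apply: sum_decr; rewrite ?rs.
Qed.

Lemma claim_p s L r :
    p < s < k -> q < #|L| -> two_level s L r -> low_potential s 0 L r ->
  exists s' r', [/\ p < s' < k, two_level s' L r', low_potential s' p L r',
    forall i, r' i <= r i & \sum_(i in L) r i = p + \sum_(i in L) r' i].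
Proof.
move=> hs qL lev low0.
suff claim_j j : j <= p -> exists s' r',
    [/\ p < s' < k, two_level s' L r', low_potential s' j L r',
      forall i, r' i <= r i & \sum_(i in L) r i = j + \sum_(i in L) r' i].
  exact: claim_j.
elim: j => [_|j IH jp]; first by exists s, r; split.
have [s1 [r1 [hs1 lev1 low1 le1 sum1]]] := IH (ltnW jp).
have [s2 [r2 [hs2 lev2 low2 le2 sum2]]] := claim_one hs1 qL jp lev1 low1.
exists s2, r2; split=> // [i|]; first exact: leq_trans (le2 i) (le1 i).
by rewrite sum1 sum2 addnS.
Qed.

(** Capping at [s.+1] does not change which boxes have size exactly [s]. *)
Lemma potential_cap s L r :
  potential s L (fun i => minn (r i) s.+1) = potential s L r.
Proof.
rewrite /potential; congr (_ + _ * _%:R)%R; apply: eq_card => i.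
by rewrite !inE; congr (_ && _); lia.
Qed.

(** At level [p] the threshold is only [q - p], so the endgame has been reached. *)
Lemma low_potential_few L r : low_potential p 0 L r -> #|L| <= q.
Proof.
rewrite /low_potential /potential /threshold subnn expr0 -(ler_nat rat).
set u := #|[set _ in _ | _]|.
have : (0 <= slope * u%:R)%R by rewrite mulr_ge0 // ltW ?slope_gt0.
have : (0 <= p%:R :> rat)%R by [].
lra.
Qed.

End Potential.

(** * The invariant and its preservation by both players *)

Section Invariant.

Variables (n : nat) (b : 'I_n -> nat) (p q k : nat).
Hypotheses (p_gt0 : 0 < p) (p_lt_k : p < k) (kp_le_q : k * p <= q).

Implicit Types (A U M : {set board b}).

(* The bound [p.+1] lets Avoider take [p] elements of any one live box. *)
Definition safe s A U : bool :=
  [&& p <= s < k, [forall i in live A U, maxn s p.+1 <= residue U i]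
    & low_potential p q k s 0 (live A U) (residue U)].

(* Position that Avoider leaves while more than [q] boxes are live: only live
   boxes have unclaimed elements, so that each of the [q] elements Enforcer takes
   next lies in a box that he kills. *)
Definition levelled s A U : bool :=
  [&& p < s < k, two_level s (live A U) (residue U),
      low_potential p q k s p (live A U) (residue U)
    & U \subset [set x | tag x \in live A U]].

(* Enforcer is forced to claim everything that is left, and thereby touches
   every box Avoider has not already lost in. *)
Definition ending A U : bool :=
  [forall i in live A U, 0 < residue U i] && (#|U| <= q).

(** With Enforcer to move, the [safe] case covers the opening when Enforcer starts. *)
Definition winning_for_avoider (P : player) A U : bool :=
  match P with
  | Avoider => [exists s : 'I_k, safe s A U]
  | Enforcer =>
      [|| [exists s : 'I_k, safe s A U], [exists s : 'I_k, levelled s A U]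
        | ending A U]
  end.

Lemma winning_start :
    (forall i, k <= b i) ->
    (n%:R <= (q%:R - p%:R) * (q%:R / (k%:R * p%:R) + 1) ^+ (k - p - 1)%N
      :> rat)%R ->
  [exists s : 'I_k, safe s set0 [set: board b]].
Proof.
move=> bk bound; have k1k : k.-1 < k by lia.
have resb i : residue [set: board b] i = b i.
  by rewrite /residue setIT card_box.
apply/existsP; exists (Ordinal k1k); rewrite /safe /=; apply/and3P; split.
- lia.
- by apply/forall_inP => i _; rewrite resb; have := bk i; lia.
rewrite /low_potential /potential mulr0 addr0.
(* At the starting level [k.-1] no box has size equal to the level, so the potential is just the
   number of live boxes. *)
rewrite [X in (_ * X%:R)%R]eq_card0 => [|i].
  rewrite mulr0 addr0 /threshold; have -> : k.-1 - p = k - p - 1 by lia.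
  apply: le_trans bound; rewrite ler_nat.
  by have := max_card (live set0 [set: board b]); rewrite card_ord.
by rewrite !inE resb; have := bk i; lia.
Qed.

(** Excludes a loss: a box filled by Avoider is live, yet has no unclaimed element. *)
Lemma winning_residue_gt0 P A U :
  winning_for_avoider P A U -> forall i, i \in live A U -> 0 < residue U i.
Proof.
have safe_gt0 : [exists s : 'I_k, safe s A U] ->
    forall i, i \in live A U -> 0 < residue U i.
  move=> /existsP[s /and3P[_ /forall_inP res _]] i /res; lia.
case: P => // /or3P[/safe_gt0//| |/andP[/forall_inP//]].
by case/existsP => s /and4P[ps /forall_inP res _ _] i /res; lia.
Qed.

Lemma avoider_step A U :
    winning_for_avoider Avoider A U ->
  exists M, [/\ M \subset U, p <= #|M| \/ M = U
    & winning_for_avoider Enforcer (M :|: A) (U :\: M)].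
Proof.
case/existsP => s /and3P[psk /forall_inP res lowp].
case: (leqP #|live A U| q) => [few|many].
  have r_le i : nat_of_bool (i \in live A U) <= residue U i.
    by case iL: (i \in live A U) => //; have := res i iL; lia.
  have [M [sM resM cardU]] := claim_to_residues r_le.
  exists M; split=> //.
    have [L0|/set0Pn[i0 i0L]] := eqVneq (live A U) set0.
      right; apply/eqP; rewrite eqEcard sM cardU L0 big1 ?addn0 ?leqnn // => i _.
      by rewrite in_set0.
    (* A single live box, with at least [p.+1] elements left, already supplies [p] of them. *)
    left; move: (card_residue U) (res i0 i0L); rewrite cardU geq_max.
    rewrite (bigD1 i0) //= [X in _ = X](bigD1 i0) //= i0L.
    set others := (X in true + X); set othersU := (X in residue U i0 + X).
    have : others <= othersU by apply: leq_sum.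
    lia.
  apply/or3P; constructor 3; rewrite /ending live_avoider_move //.
  apply/andP; split; first by apply/forall_inP => i iL; rewrite resM iL.
  rewrite card_residue (eq_bigr _ (fun i _ => resM i)).
  by rewrite -big_mkcond sum1_card.
have ps : p < s < k.
  case/andP: psk => ps ->; rewrite ltn_neqAle ps !andbT.
  apply: contraTneq many => ps'; rewrite -leqNgt.
  by rewrite -ps' in lowp; exact: low_potential_few lowp.
pose r0 i := minn (residue U i) s.+1.
have lev0 : two_level s (live A U) r0.
  by apply/forall_inP => i /res; rewrite /r0; lia.
have low0 : low_potential p q k s 0 (live A U) r0.
  by rewrite /low_potential potential_cap.
have [s' [r1 [ps' lev1 low1 le1 sum1]]] :=
  claim_p p_gt0 p_lt_k kp_le_q ps many lev0 low0.
(* The value 0 makes Avoider claim all that is left in dead boxes. *)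
pose r i := if i \in live A U then r1 i else 0.
have r_le i : r i <= residue U i.
  by rewrite /r; case: ifP => // _; apply: leq_trans (le1 i) (geq_minl _ _).
have [M [sM resM cardU]] := claim_to_residues r_le.
have sum_r : \sum_i r i = \sum_(i in live A U) r1 i by rewrite -big_mkcond.
exists M; split=> //.
  left; move: cardU; rewrite sum_r (card_residue U).
  have : \sum_(i in live A U) r0 i <= \sum_i residue U i.
    rewrite [leqRHS](bigID (mem (live A U))) /= -[leqLHS]addn0 leq_add //.
    by apply: leq_sum => i _; apply: geq_minl.
  lia.
have rL : {in live A U, residue (U :\: M) =1 r1}.
  by move=> i iL; rewrite resM /r iL.
have s'k : s' < k by case/andP: ps'.
apply/or3P; constructor 2; apply/existsP; exists (Ordinal s'k).
rewrite /levelled live_avoider_move //= ps' /=; apply/and3P; split.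
- by apply/forall_inP => i iL; rewrite rL // (forall_inP lev1).
- by apply: le_trans low1; apply: potentialS.
- apply/subsetP => x xU; rewrite inE.
  have : 0 < residue (U :\: M) (tag x).
    by apply/card_gt0P; exists x; rewrite mem_boxI eqxx.
  by rewrite resM /r; case: ifP.
Qed.

Lemma enforcer_step A U M :
    [disjoint A & U] -> M \subset U -> q <= #|M| \/ M = U ->
    winning_for_avoider Enforcer A U ->
  winning_for_avoider Avoider A (U :\: M).
Proof.
move=> dAU sMU large win.
have resL := residue_enforcer_move dAU sMU.
have sL := live_enforcer_move A U M.
have Lres i (iL : i \in live A (U :\: M)) := subsetP sL i iL.
have all_claimed : M = U -> winning_for_avoider Avoider A (U :\: M).
  move=> MU; apply/existsP; exists (Ordinal p_lt_k).
  (* No box is live any more, so level [p] is safe for trivial reasons. *)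
  rewrite /safe (live_enforcer_all dAU sMU (winning_residue_gt0 win) MU).
  apply/and3P; split; [by rewrite leqnn | | exact: low_potential0].
  by apply/forall_inP => i; rewrite in_set0.
case: (boolP (M == U)) => [/eqP//|MU].
have {large} qM : q <= #|M| by case: large MU => // ->; rewrite eqxx.
case/or3P: win => [||/andP[_ Uq]].
- case/existsP => s /and3P[ps /forall_inP res low0].
  apply/existsP; exists s; rewrite /safe ps /=; apply/andP; split.
    by apply/forall_inP => i iL; rewrite resL // res // Lres.
  by apply: le_trans low0; apply: potentialS.
- case/existsP => s /and4P[ps /forall_inP res lowp /subsetP supp].
  apply/existsP; exists s; rewrite /safe; apply/and3P; split.
  + lia.
  + by apply/forall_inP => i iL; rewrite resL //; have := res i (Lres i iL); lia.
  pose D := live A U :\: live A (U :\: M).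
  (* All elements of [M] lie in killed boxes, each with at most [s.+1 <= k] elements. Hence at least
     [q / k = slope * p] boxes die, which repays the slack of Avoider's [p] single steps. *)
  have killed : q <= k * #|D|.
    apply: leq_trans qM _; rewrite card_residue (bigID (mem D)) /=.
    rewrite [X in _ + X]big1 ?addn0.
      rewrite mulnC -sum_nat_const; apply: leq_sum => i.
      rewrite inE => /andP[_ /res]; have := residueS i sMU; have := ltn_ord s.
      lia.
    move=> i iD; apply/eqP; rewrite cards_eq0; apply/set0Pn => -[x].
    rewrite mem_boxI => /andP[/eqP ti xM]; case/negP: iD.
    rewrite inE -ti (live_enforcer_moveP dAU sMU xM) /=.
    by have := supp x (subsetP sMU x xM); rewrite inE.
  have k0 : (0 < k%:R :> rat)%R by rewrite ltr0n; lia.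
  have D_ge : (slope p q k * p%:R <= #|D|%:R)%R.
    by rewrite -(ler_pM2r k0) slopeMp // -natrM ler_nat mulnC.
  have drop := potential_drop p_gt0 p_lt_k kp_le_q s sL resL.
  by move: lowp; rewrite /low_potential mulr0 addr0; lra.
- by case/negP: MU; rewrite eqEcard sMU (leq_trans Uq).
Qed.

End Invariant.

Theorem theorem1p6 (p q k n : nat)
  (hp : 0 < p) (hq : 0 < q) (hk : 0 < k) (hn : 0 < n)
  (hkp : p < k) (hqkp : k * p <= q)
  (hbound : (n%:R <= (q%:R - p%:R) * (q%:R / (k%:R * p%:R) + 1) ^+ (k - p - 1)%N
             :> rat)%R)
  (b : 'I_n -> nat)
  (hb_ge : forall i : 'I_n, k <= b i)
  (hb_mono : forall i j : 'I_n, i <= j -> b i <= b j) :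
  avoider_wins_mBox b p q Avoider /\ avoider_wins_mBox b p q Enforcer.
Proof.
have start := winning_start hp hkp hqkp hb_ge hbound.
suff wins first : avoider_wins_mBox b p q first by [].
pose I (h : history (board b)) := winning_for_avoider p q k (to_move first h)
  (claimed_by_avoider first h) (unclaimed h).
apply: (@winning_strategy_of_invariant _ _ _ _ _ I).
- by rewrite /I unclaimed_nil /to_move /= {I}; case: first; rewrite /= start.
- move=> h hA; rewrite {1}/I hA => /(avoider_step hp hkp hqkp)[M [sM large win]].
  exists M; first by apply/legal_moveP; rewrite hA.
  by rewrite /I to_move_cons /= hA unclaimed_cons.
- move=> h M hE; rewrite {1}/I hE => win /legal_moveP; rewrite hE => -[sM large].
  rewrite /I to_move_cons /= hE unclaimed_cons; apply: enforcer_step win => //.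
  exact: claimed_by_avoider_disjoint.
- move=> h /eqP over win [T /imsetP[i _ ->] sT].
  have iL : i \in live (claimed_by_avoider first h) (unclaimed h).
    by rewrite inE (subset_trans sT) // subsetUl.
  by have := winning_residue_gt0 hp hkp hqkp win iL; rewrite over /residue setI0 cards0.
Qed.
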